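(* Let $A=(a_{ij})$ be a real $n\times n$ matrix with sparsity pattern $\mathcal{S}$, having positive diagonal entries and non-negative row sums (i.e. $a_{ii}>0$ and $\sum_{j} a_{ij}\ge 0$ for every $i$). Let $\tilde{\mathcal{S}}\subseteq \mathcal{S}$ be a sparsity pattern containing all diagonal positions $(i,i)$, $1\le i\le n$. For each row $i$ put $$e_i=\sum_{k \,:\, (i,k)\in \mathcal{S}\setminus\tilde{\mathcal{S}}} a_{ik},$$ and let $\tilde A=(\tilde a_{ij})$ be the $n\times n$ matrix with $\tilde a_{ij}=0$ for $(i,j)\notin\tilde{\mathcal{S}}$ and, for $(i,j)\in\tilde{\mathcal{S}}$, $$\tilde a_{ij}=\begin{cases} a_{ij}+e_i\,\dfrac{|a_{ij}|}{\sum_{k\,:\,(i,k)\in\tilde{\mathcal{S}}}|a_{ik}|} & \text{if } e_i<0,\\[2mm] a_{ij} & \text{if } e_i\ge 0 \text{ and } i\ne j,\\[1mm] a_{ij}+e_i & \text{if } e_i\ge 0 \text{ and } i=j.\end{cases}$$ Assume additionally that for every row $i$ there exists at least one $(i,k)\in\tilde{\mathcal{S}}$ such that $k\ne i$ and $a_{ik}<0$. Then the following two properties hold: 1. For all $(i,j)\in\tilde{\mathcal{S}}$, $\operatorname{sgn}(a_{ij})=\operatorname{sgn}(\tilde a_{ij})$. 2. For all $i$, $\sum_{j} a_{ij}=\sum_{j}\tilde a_{ij}$.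
   Context: The sparsity pattern $\mathcal{S}$ of $A$ is the set of index pairs $(i,j)$ with $a_{ij}\neq 0$; thus $a_{ij}=0$ for $(i,j)\notin\mathcal{S}$. The set $\tilde{\mathcal{S}}$ consists of the retained positions, and the entries of $A$ at positions in $\mathcal{S}\setminus\tilde{\mathcal{S}}$ are dropped, so $e_i$ is the sum of the dropped entries in row $i$. The function $\operatorname{sgn}$ is the usual sign function. *)

(* Defs.v *)
From mathcomp Require Import all_boot all_order all_algebra.

Set Implicit Arguments.
Unset Strict Implicit.
Unset Printing Implicit Defensive.

Import Order.TTheory GRing.Theory Num.Theory.
Local Open Scope ring_scope.

Definition sparsity_pattern (R : realFieldType) (n : nat) (A : 'M[R]_n) :
    {set 'I_n * 'I_n} :=
  [set p : 'I_n * 'I_n | A p.1 p.2 != 0].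

Definition dropped_sum (R : realFieldType) (n : nat) (A : 'M[R]_n)
    (St : {set 'I_n * 'I_n}) (i : 'I_n) : R :=
  \sum_(k < n | (i, k) \in sparsity_pattern A :\: St) A i k.

Definition sparsify (R : realFieldType) (n : nat) (A : 'M[R]_n)
    (St : {set 'I_n * 'I_n}) : 'M[R]_n :=
  \matrix_(i < n, j < n)
    if (i, j) \notin St then 0
    else if dropped_sum A St i < 0 then
      A i j + dropped_sum A St i *
        (`|A i j| / \sum_(k < n | (i, k) \in St) `|A i k|)
    else if i != j then A i j
    else A i j + dropped_sum A St i.

(* Main.v *)
Require Import Defs.
From mathcomp Require Import all_boot all_order all_algebra.

Set Implicit Arguments.
Unset Strict Implicit.
Unset Printing Implicit Defensive.

Import Order.TTheory GRing.Theory Num.Theory.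
Local Open Scope ring_scope.

(** Fix a row; let s be the sum of its retained entries, e the sum of its
    dropped ones, and T the sum of the absolute values of the retained ones.

    Row sums: entries outside the sparsity pattern vanish, so the original row
    sum is s + e ([row_sum_split]).  Sparsification puts e back into the
    retained positions, either all of it on the diagonal or in shares
    |a_ij| / T, which add up to 1.

    Signs: the diagonal is positive, so adding e >= 0 to it is harmless.
    When e < 0 an entry a becomes a + c |a| with c = e / T, which has the sign
    of a as soon as |c| < 1 ([sgr_add_scaled_norm]).  A retained negative entry
    makes s < T strictly ([ltr_sum_norm]), so 0 <= s + e < T + e, which is
    -1 < c ([dropped_ratio_lt1]). *)

(** Since |a| = sg a * a, the perturbed value is a * (1 + c * sg a), and the
    second factor is positive. *)
Lemma sgr_add_scaled_norm (R : realFieldType) (a c : R) :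
  `|c| < 1 -> Num.sg (a + c * `|a|) = Num.sg a.
Proof.
move=> c_lt1; rewrite normrEsg mulrA -{1}[a]mul1r -mulrDl sgrM.
suff /gtr0_sg-> : 0 < 1 + c * Num.sg a by rewrite mul1r.
have : `|c * Num.sg a| < 1.
  apply: le_lt_trans c_lt1; rewrite normrM ler_piMr // normr_sg.
  by case: (a != 0).
by rewrite ltr_norml => /andP[+ _]; rewrite -subr_gt0 opprK addrC.
Qed.

Lemma ltr_sum_norm (R : realFieldType) (I : finType) (P : pred I) (f : I -> R)
    (k : I) :
  P k -> f k < 0 -> \sum_(i | P i) f i < \sum_(i | P i) `|f i|.
Proof.
move=> Pk fk_lt0; rewrite (bigD1 k) //= [ltRHS](bigD1 k) //=.
apply: ltr_leD; first by rewrite (lt_le_trans fk_lt0).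
by apply: ler_sum => i _; apply: ler_norm.
Qed.

Section Row.
Variables (R : realFieldType) (n : nat) (A : 'M[R]_n).
Variables (St : {set 'I_n * 'I_n}) (i : 'I_n).

Lemma row_sum_split :
  \sum_j A i j = \sum_(j | (i, j) \in St) A i j + dropped_sum A St i.
Proof.
rewrite (bigID (fun j => (i, j) \in St)) /=; congr (_ + _).
rewrite /dropped_sum [RHS]big_mkcond [LHS]big_mkcond.
apply: eq_bigr => j _; rewrite !inE /=.
by case: ((i, j) \in St) => //=; case: eqP.
Qed.

Lemma sparsify_row_sum :
  \sum_j sparsify A St i j = \sum_(j | (i, j) \in St) sparsify A St i j.
Proof.
rewrite [RHS]big_mkcond; apply: eq_bigr => j _; rewrite mxE.
by case: ((i, j) \in St).
Qed.

Lemma sparsify_neg j :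
    dropped_sum A St i < 0 -> (i, j) \in St ->
  sparsify A St i j =
    A i j + dropped_sum A St i / (\sum_(k | (i, k) \in St) `|A i k|) * `|A i j|.
Proof. by move=> e_lt0 Sij; rewrite mxE Sij e_lt0 mulrA mulrAC. Qed.

Lemma sparsify_nneg j :
    0 <= dropped_sum A St i -> (i, j) \in St ->
  sparsify A St i j = A i j + (if j == i then dropped_sum A St i else 0).
Proof.
move=> e_ge0 Sij; rewrite mxE Sij ltNge e_ge0 /= eq_sym.
by case: eqP => //=; rewrite addr0.
Qed.

Lemma dropped_ratio_lt1 :
    0 <= \sum_j A i j ->
    \sum_(j | (i, j) \in St) A i j < \sum_(j | (i, j) \in St) `|A i j| ->
    dropped_sum A St i < 0 ->
  `|dropped_sum A St i / \sum_(j | (i, j) \in St) `|A i j| | < 1.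
Proof.
rewrite row_sum_split; set T := \sum_(j | _) `|_| => sum_ge0 s_ltT e_lt0.
have lt_eT : - dropped_sum A St i < T.
  by apply: le_lt_trans s_ltT; rewrite -subr_ge0 opprK.
have T_gt0 : 0 < T by apply: lt_trans lt_eT; rewrite oppr_gt0.
by rewrite normrM normfV (gtr0_norm T_gt0) (ltr0_norm e_lt0) ltr_pdivrMr ?mul1r.
Qed.

Lemma sparsify_preserves_row_sum :
    (i, i) \in St -> \sum_(j | (i, j) \in St) `|A i j| != 0 ->
  \sum_j A i j = \sum_j sparsify A St i j.
Proof.
move=> Sii T_neq0; rewrite row_sum_split sparsify_row_sum.
have [e_ge0|e_lt0] := leP 0 (dropped_sum A St i).
  rewrite (eq_bigr _ (fun j => sparsify_nneg e_ge0)) big_split /=.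
  congr (_ + _); rewrite -big_mkcondr (big_pred1 i) // => j /=.
  by case: eqP => [->|_]; rewrite ?Sii ?andbF.
rewrite (eq_bigr _ (fun j => sparsify_neg e_lt0)) big_split /= -mulr_sumr.
by rewrite divfK.
Qed.

End Row.

Theorem theorem3p1 (R : realFieldType) (n : nat) (A : 'M[R]_n)
    (St : {set 'I_n * 'I_n})
    (diag_pos : forall i : 'I_n, 0 < A i i)
    (row_sum_ge0 : forall i : 'I_n, 0 <= \sum_(j < n) A i j)
    (St_sub : St \subset sparsity_pattern A)
    (St_diag : forall i : 'I_n, (i, i) \in St)
    (St_neg : forall i : 'I_n, exists k : 'I_n,
        [/\ (i, k) \in St, k != i & A i k < 0]) :
  (forall i j : 'I_n, (i, j) \in St ->
     Num.sg (A i j) = Num.sg (sparsify A St i j)) /\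
  (forall i : 'I_n, \sum_(j < n) A i j = \sum_(j < n) sparsify A St i j).
Proof.
split=> [i j Sij | i].
  have [e_ge0|e_lt0] := leP 0 (dropped_sum A St i).
    rewrite sparsify_nneg //; case: eqP => [->|_]; last by rewrite addr0.
    by rewrite !gtr0_sg // ltr_wpDr.
  rewrite sparsify_neg // sgr_add_scaled_norm // dropped_ratio_lt1 //.
  by have [k [Sik _ Aik_lt0]] := St_neg i; apply: (ltr_sum_norm (k := k)).
apply: sparsify_preserves_row_sum => //.
rewrite gt_eqF // (bigD1 i) //= ltr_wpDr ?sumr_ge0 //.
by rewrite normr_gt0 gt_eqF.
Qed.
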